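(* Let $k\geq 1$ and $n\geq 3$ be integers. If $n\leq 2k+1$, then $\operatorname{sdepth}(I(C_n^k))\geq 2$. If $n\geq 2k+2$, then $\operatorname{sdepth}(I(C_n^k))\geq\left\lceil\frac{n-k}{2k+1}\right\rceil+1$.
   Context: $K$ is a field and $S=K[x_1,\dots,x_n]$ is the polynomial ring. $C_n^k$ denotes the $k$-th power of the cycle on the vertex set $\{1,\dots,n\}$ ($n\ge 3$): for $1\le i<j\le n$, $\{i,j\}$ is an edge if and only if $j-i\le k$ or $j-i\ge n-k$ (so $C_n^k$ is the complete graph when $n\le 2k+1$). Its edge ideal $I(C_n^k)\subset S$ is the squarefree monomial ideal generated by all $x_ix_j$ with $\{i,j\}$ an edge of $C_n^k$, regarded as a $\mathbb{Z}^n$-graded $S$-module. Stanley depth: let $M$ be a finitely generated $\mathbb{Z}^n$-graded $S$-module. A Stanley decomposition of $M$ is a presentation of the $K$-vector space $M$ as a finite direct sum $\mathcal{D}: M=\bigoplus_{i=1}^s v_iK[W_i]$, where each $v_i\in M$ is homogeneous, $W_i\subseteq\{x_1,\dots,x_n\}$, $v_iK[W_i]$ is the $K$-subspace generated by all $v_iw$ with $w$ a monomial in $K[W_i]$, and $v_iK[W_i]$ is a free $K[W_i]$-module. Put $\operatorname{sdepth}(\mathcal{D})=\min_i |W_i|$, and $\operatorname{sdepth}(M)=\max\{\operatorname{sdepth}(\mathcal{D}):\mathcal{D}\text{ a Stanley decomposition of }M\}$. *)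

(* Defs.v *)
From mathcomp Require Import all_boot all_order all_algebra.
From mathcomp Require Import boolp.
From mathcomp Require Export mpoly.

Set Implicit Arguments.
Unset Strict Implicit.
Unset Printing Implicit Defensive.

Import GRing.Theory.
Local Open Scope ring_scope.

(* The vertices 1, ..., n are shifted to 0, ..., n-1; only differences of
   vertices occur.  When k > n the truncated n - k is 0, which gives the same
   condition as the negative integer. *)
Definition cycle_power (n k : nat) : rel 'I_n :=
  fun i j =>
    let adj (a b : nat) := [&& a < b & (b - a <= k) || (n - k <= b - a)]%N in
    adj i j || adj j i.

Section Ideals.
Variables (K : fieldType) (n : nat).
Local Notation S := {mpoly K[n]}.

Definition ideal_gen (G : S -> Prop) : S -> Prop :=
  fun p => exists (m : nat) (a g : 'I_m -> S),
    (forall t, G (g t)) /\ p = \sum_t a t * g t.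

Definition edge_ideal (e : rel 'I_n) : S -> Prop :=
  ideal_gen (fun g => exists i j : 'I_n, e i j /\ g = 'X_i * 'X_j).

(* Homogeneity for the Z^n-grading of S, in which x_1^(m_1) ... x_n^(m_n) has
   degree (m_1, ..., m_n). *)
Definition Zn_homogeneous (p : S) : Prop :=
  exists a : 'I_n -> int,
    forall m, m \in msupp p -> forall i, (m i)%:Z = a i.

(* The polynomial subring K[W]. *)
Definition subpoly (W : {set 'I_n}) (q : S) : Prop :=
  forall m, m \in msupp q -> forall i, i \notin W -> m i = 0%N.

(* The K-span v K[W] of all v w, with w a monomial in K[W]. *)
Definition stanley_space (v : S) (W : {set 'I_n}) (p : S) : Prop :=
  exists q, subpoly W q /\ p = v * q.

(* Stanley decompositions of a Z^n-graded submodule (i.e. monomial ideal) M of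
   S, with the grading and the action inherited from S. *)
Record stanley_decomposition (M : S -> Prop) := StanleyDecomposition {
  sd_size : nat;
  sd_gen : 'I_sd_size -> S;
  sd_vars : 'I_sd_size -> {set 'I_n};
  sd_genP : forall i, M (sd_gen i);
  sd_homog : forall i, Zn_homogeneous (sd_gen i);
  (* v_i K[W_i] is free over K[W_i], with basis v_i *)
  sd_free : forall i q, subpoly (sd_vars i) q -> sd_gen i * q = 0 -> q = 0;
  sd_sum : forall p, M p <->
    exists f : 'I_sd_size -> S,
      (forall i, stanley_space (sd_gen i) (sd_vars i) (f i)) /\
      p = \sum_i f i;
  sd_direct : forall f : 'I_sd_size -> S,
    (forall i, stanley_space (sd_gen i) (sd_vars i) (f i)) ->
    \sum_i f i = 0 -> forall i, f i = 0
}.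

(* The default value n of the minimum is an upper bound of all the |W_i|, so it
   only matters for the empty decomposition, i.e. for M = 0. *)
Definition sdepth_dec (M : S -> Prop) (D : stanley_decomposition M) : nat :=
  \big[minn/n]_(i < sd_size D) #|@sd_vars M D i|.

(* Since sdepth_dec D <= n, this is the maximum over all D; it is 0 if M has no
   Stanley decomposition. *)
Definition sdepth (M : S -> Prop) : nat :=
  \max_(d < n.+1 | `[< exists D : stanley_decomposition M,
                        sdepth_dec D = d >]) d.

End Ideals.

Arguments cycle_power n k _ _ : clear implicits.
Arguments edge_ideal K {n} e _.

(* Main.v *)
(* A partition of the sets of vertices containing an edge into intervals [F, G]
   with |G| >= d yields a Stanley decomposition of the edge ideal into the spaces
   x_F K[G], since a monomial m lies in x_F K[G] iff F <= supp m <= G.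

   Such partitions are built by deleting a vertex v from a vertex set X.  The
   sets avoiding v live on X - v; those containing v but none of its neighbours
   are v together with a set containing an edge in X - N[v], which gains one in
   |G|; those containing v and a neighbour are split by their first neighbour
   into intervals with |G| >= |X - N[v]| + 2.  A vertex isolated in X can be
   added freely to all intervals, which also gains one.

   For a path 0, ..., m-1, delete 1, ..., k in turn, after which 0 is isolated:
   every step leaves a path with at least m - 2k - 1 vertices.  For the cycle,
   delete the k last vertices to reach a path on n - k vertices; each time
   X - N[v] is a path on n - 2k - 1 vertices. *)
Require Import Defs.
From mathcomp Require Import all_boot all_order all_algebra.
From mathcomp Require Import boolp zify.

Set Implicit Arguments.
Unset Strict Implicit.
Unset Printing Implicit Defensive.

Import GRing.Theory Num.Theory.

(** * Interval partitions of families of finite sets *)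

Section Intervals.
Variable T : finType.
Implicit Types (A C F G X Y N : {set T}) (P Q : pred {set T}).

Definition between (p : {set T} * {set T}) A := (p.1 \subset A) && (A \subset p.2).

(** The boolean [P A] is read as 0 or 1, so the count expresses disjointness and covering at
    once. *)
Definition interval_partition d P (s : seq ({set T} * {set T})) :=
  all (fun p : {set T} * {set T} => (p.1 \subset p.2) && (d <= #|p.2|)) s /\
  forall A, count (between^~ A) s = P A.

Definition partitionable d P := exists s, interval_partition d P s.

Lemma interval_partition_ends d P s p :
  interval_partition d P s -> p \in s -> P p.1 /\ P p.2.
Proof.
move=> [/allP ok cnt] ps; have /andP[FG _] := ok _ ps.
have P_between A : between p A -> P A.
  move=> pA; have : 0 < count (between^~ A) s by rewrite -has_count; apply/hasP; exists p.
  by rewrite cnt; case: (P A).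
by split; apply: P_between; rewrite /between subxx FG.
Qed.

Lemma eq_partitionable d P Q : P =1 Q -> partitionable d P -> partitionable d Q.
Proof. by move=> PQ [s [ok cnt]]; exists s; split=> // A; rewrite -PQ. Qed.

Lemma partitionableU d P Q : (forall A, P A -> ~~ Q A) ->
  partitionable d P -> partitionable d Q -> partitionable d (predU P Q).
Proof.
move=> dPQ [s [oks cs]] [t [okt ct]]; exists (s ++ t).
split=> [|A]; first by rewrite all_cat oks okt.
rewrite count_cat cs ct /=; have := dPQ A.
by case: (P A) (Q A) => [] [] // /(_ isT).
Qed.

Lemma partitionable0 d : partitionable d pred0.
Proof. by exists [::]. Qed.

Lemma partitionable_between d F G :
  F \subset G -> d <= #|G| -> partitionable d (between (F, G)).
Proof. by move=> FG dG; exists [:: (F, G)]; split=> [|A] /=; rewrite ?FG ?dG ?addn0. Qed.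

Lemma partitionable_large d P : (forall A, P A -> d <= #|A|) -> partitionable d P.
Proof.
move=> Pd; exists [seq (A, A) | A <- enum P]; split=> [|A].
  by apply/allP=> p /mapP[A]; rewrite mem_enum => PA ->; rewrite subxx Pd.
rewrite count_map (eq_count (a2 := pred1 A)) => [|B]; last by rewrite /= eqEsubset.
by rewrite count_uniq_mem ?enum_uniq // mem_enum.
Qed.

(* [C = set0] makes [v] a free vertex, [C = [set v]] a compulsory one. *)
Lemma partitionable_vertex d P v C : C \subset [set v] ->
  (forall A, P A -> v \notin A) -> partitionable d P ->
  partitionable d.+1 (fun A => (C \subset A) && P (A :\ v)).
Proof.
move=> Cv vP [s s_part]; have [/allP ok cnt] := s_part.
exists [seq (C :|: p.1, v |: p.2) | p <- s]; split=> [|A].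
  apply/allP=> _ /mapP[p ps ->] /=; have [_ /vP vG] := interval_partition_ends s_part ps.
  have /andP[FG dG] := ok _ ps.
  by rewrite cardsU1 vG ltnS dG andbT setUSS.
rewrite count_map; have [CA|nCA] /= := boolP (C \subset A); last first.
  rewrite (eq_count (a2 := pred0)) ?count_pred0 // => p /=.
  by rewrite /between subUset (negPf nCA).
rewrite -cnt; apply: eq_in_count => p ps /=.
have [/vP vF /vP vG] := interval_partition_ends s_part ps.
by rewrite /between subUset CA /= -subDset subsetD1 vF andbT.
Qed.

(** Pick [w] in [N]: the sets containing [w] form one interval, and the others live on [X :\ w] and
    meet [N :\ w]. The difference [X :\: N] never changes, and each top contains it together with
    the current [w]. *)
Lemma partitionable_meet d F N X : N \subset X -> F \subset X :\: N ->
  d <= #|X :\: N|.+1 ->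
  partitionable d (fun A => between (F, X) A && (A :&: N != set0)).
Proof.
elim: {N}#|N| {-2}N (leqnn #|N|) X => [|m IH] N.
  rewrite leqn0 cards_eq0 => /eqP-> X _ _ _.
  by apply: eq_partitionable (partitionable0 d) => A; rewrite setI0 eqxx andbF.
have [->|[w wN]] := set_0Vmem N => Nm X NX FX dX.
  by apply: eq_partitionable (partitionable0 d) => A; rewrite setI0 eqxx andbF.
have wX : w \in X := subsetP NX _ wN.
have XN : (X :\ w) :\: (N :\ w) = X :\: N.
  by apply/setP=> x; rewrite !inE; case: eqVneq => // ->; rewrite wN.
have FXX : F \subset X := subset_trans FX (subsetDl _ _).
have wF : w \notin F by apply/negP=> /(subsetP FX); rewrite !inE wN.
have part1 : partitionable d (between (w |: F, X)).
  apply: partitionable_between; first by rewrite subUset sub1set wX.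
  apply: leq_trans dX _; apply: proper_card; rewrite properE subsetDl /=.
  by apply/negP=> /subsetP/(_ _ wX); rewrite inE wN.
have part2 := IH (N :\ w) _ (X :\ w).
rewrite XN in part2.
apply: eq_partitionable (partitionableU _ part1 (part2 _ _ FX dX)).
- move=> A /=; rewrite /between /= subUset sub1set subsetD1.
  have [wA|wA] /= := boolP (w \in A); rewrite ?andbF ?orbF ?andbT.
    suff -> : A :&: N != set0 by rewrite andbT.
    by apply/set0Pn; exists w; rewrite inE wA.
  congr (_ && (_ != _)); apply/setP=> x; rewrite !inE.
  by case: eqVneq => // ->; rewrite (negPf wA).
- move=> A /andP[/= FA _]; rewrite /between /= subsetD1 negb_and; apply/orP; left.
  by move: FA; rewrite subUset sub1set => /andP[-> _]; rewrite !andbF.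
- by rewrite (cardsD1 w N) wN in Nm.
- exact: setSD.
Qed.

End Intervals.

(** * Vertex sets containing an edge, and deletion of a vertex *)

Section Dependent.
Variables (T : finType) (e : rel T).
Hypotheses (e_sym : symmetric e) (e_irr : irreflexive e).
Implicit Types (A B X : {set T}).

Definition has_edge A := [exists i in A, exists j in A, e i j].

Definition dependent X A := (A \subset X) && has_edge A.

Lemma has_edgeP A :
  reflect (exists i j, [/\ i \in A, j \in A & e i j]) (has_edge A).
Proof.
apply: (iffP exists_inP) => [[i iA /exists_inP[j jA eij]]|[i [j [iA jA eij]]]].
  by exists i, j.
by exists i => //; apply/exists_inP; exists j.
Qed.

Lemma has_edgeS A B : A \subset B -> has_edge A -> has_edge B.
Proof.
move=> /subsetP AB /has_edgeP[i [j [iA jA eij]]].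
by apply/has_edgeP; exists i, j; split; rewrite ?AB.
Qed.

(** The bound on [#|X|] is carried along because, in [good_delete], the tops of the intervals given
    by [partitionable_meet] are estimated by cardinality alone. *)
Definition good d X := d < #|X| /\ partitionable d.+2 (dependent X).

(** An edge has two distinct ends, so one-element intervals already have tops of size at least 2. *)
Lemma good0 X v : v \in X -> good 0 X.
Proof.
move=> vX; split; first by apply/card_gt0P; exists v.
apply: partitionable_large => A /andP[_ /has_edgeP[i [j [iA jA eij]]]].
rewrite (cardsD1 i) iA ltnS card_gt0; apply/set0Pn; exists j.
by rewrite !inE jA andbT; apply: contraTneq eij => ->; rewrite e_irr.
Qed.

Lemma has_edgeD1 A v : (forall w, w \in A -> ~~ e v w) ->
  has_edge A = has_edge (A :\ v).
Proof.
move=> iso; apply/idP/idP; last by apply: has_edgeS; rewrite subsetDl.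
move=> /has_edgeP[i [j [iA jA eij]]]; apply/has_edgeP; exists i, j; split=> //.
  by rewrite !inE iA andbT; apply: contraTneq eij => ->; apply: iso.
by rewrite !inE jA andbT; apply: contraTneq eij => ->; rewrite e_sym; apply: iso.
Qed.

Lemma good_isolated d X v : v \in X -> (forall w, w \in X -> ~~ e v w) ->
  good d (X :\ v) -> good d.+1 X.
Proof.
move=> vX iso [dX part]; split; first by rewrite (cardsD1 v) vX ltnS.
have Dv A : dependent (X :\ v) A -> v \notin A.
  by case/andP=> + _; rewrite subsetD1 => /andP[].
apply: eq_partitionable (partitionable_vertex (sub0set _) Dv part) => A.
rewrite sub0set /= /dependent subsetD1 !inE eqxx andbT /=.
have -> : (A :\ v \subset X) = (A \subset X).
  by rewrite subDset (setUidPr _) // sub1set.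
have [AX|//] /= := boolP (A \subset X).
by rewrite -has_edgeD1 // => w /(subsetP AX)/iso.
Qed.

Lemma good_delete d X v : v \in X -> good d.+1 (X :\ v) ->
  good d [set w in X | (w != v) && ~~ e v w] -> good d.+1 X.
Proof.
set Y := finset _ => vX [dX part1] [dY part2].
split; first by rewrite (leq_trans dX) // subset_leq_card // subsetDl.
pose N := [set w in X | e v w].
have vN : v \notin N by rewrite inE e_irr andbF.
have Dv A : dependent Y A -> v \notin A.
  by move=> /andP[/subsetP AY _]; apply/negP=> /AY; rewrite inE eqxx andbF.
have {}part2 := partitionable_vertex (subxx [set v]) Dv part2.
have XN : X :\: N = v |: Y.
  apply/setP=> w; rewrite !inE; case: eqVneq => [->|]; rewrite ?vX ?e_irr //=.
  by case: (w \in X); case: (e v w).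
have part3 : partitionable d.+3 (fun A => between ([set v], X) A && (A :&: N != set0)).
  apply: partitionable_meet; first by apply/subsetP=> w; rewrite inE => /andP[].
    by rewrite sub1set !inE vX e_irr andbF.
  by rewrite XN cardsU1 !inE eqxx andbF !ltnS.
have part23 := partitionableU _ part2 part3.
apply: eq_partitionable (partitionableU _ part1 (part23 _)) => [A|A|A] /=.
- rewrite /dependent /between /= !subsetD1 sub1set.
  have [vA|vA] /= := boolP (v \in A); rewrite ?andbT ?andbF ?orbF //=.
  (* If [A] misses [N], then [v] lies on no edge of [A], and removing it keeps [has_edge]; otherwise
     [v] and a neighbour form an edge, and only [A \subset X] matters. *)
  have [/eqP AN|AN] /= := eqVneq (A :&: N) set0; rewrite ?andbF ?andbT ?orbF.
    have AX_Y : (A :\ v \subset Y) = (A \subset X).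
      apply/subsetP/subsetP => [AY w wA|AX w].
        have [->//|wv] := eqVneq w v.
        by have := AY w; rewrite !inE wv wA => /(_ isT)/andP[].
      rewrite !inE => /andP[wv wA]; rewrite wv AX //=.
      apply/negP=> vw; have : w \in A :&: N by rewrite !inE wA AX.
      by rewrite (eqP AN) inE.
    rewrite AX_Y; have [AX|//] /= := boolP (A \subset X).
    rewrite -has_edgeD1 // => w wA; apply/negP=> vw.
    have : w \in A :&: N by rewrite !inE wA vw (subsetP AX).
    by rewrite (eqP AN) inE.
  have -> : has_edge A.
    have /set0Pn[w] := AN; rewrite !inE => /and3P[wA _ vw].
    by apply/has_edgeP; exists v, w.
  rewrite andbT; apply: orb_idl => /andP[/subsetP AY _]; apply/subsetP=> w wA.
  have [->//|wv] := eqVneq w v.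
  by have := AY w; rewrite !inE wv wA => /(_ isT)/andP[].
- rewrite /dependent subsetD1 -!andbA => /and3P[_ vA _].
  by rewrite /between /= sub1set (negPf vA).
- rewrite sub1set => /andP[vA /andP[/subsetP AY _]]; rewrite negb_and negbK.
  apply/orP; right; apply/eqP/setP=> w; rewrite !inE; apply/negP=> /and3P[wA wX vw].
  have := AY w; rewrite !inE wA andbT vw !andbF.
  by case: eqVneq vw => [->|_ _ /(_ isT)//]; rewrite e_irr.
Qed.

End Dependent.

(** * Segments of the cycle power, then the whole cycle *)

Section CyclePower.
Variables n k : nat.
Local Notation e := (cycle_power n k).

Lemma cycle_power_sym : symmetric e.
Proof. by move=> i j; rewrite /cycle_power orbC. Qed.

Lemma cycle_power_irr : irreflexive e.
Proof. by move=> i; rewrite /cycle_power /= ltnn. Qed.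

Definition segment a b := [set i : 'I_n | a <= i < b].

(** Differences within the segment stay below [n - k], so no edge wraps around and the segment
    induces a power of a path. *)
Lemma good_segment d a b : b <= n -> b - a <= n - k -> d * (2 * k + 1) < b - a ->
  good e d (segment a b).
Proof.
elim: d a b => [|d IH] a b bn abk dab.
  have an : a < n by lia.
  by apply: (good0 cycle_power_irr (v := Ordinal an)); rewrite inE /=; lia.
have an : a < n by lia.
(* Here [j] counts the vertices among [a + 1], ..., [a + k] not yet deleted: [j = k] is the full
   segment, and at [j = 0] the vertex [a] is isolated. *)
suff step j : j <= k -> good e d.+1
    [set i : 'I_n | (i == a :> nat) || (a + (k - j).+1 <= i < b)].
  have := step k (leqnn k); congr (good e _ _); apply/setP=> i; rewrite !inE; lia.
elim: j => [|j IHj] jk.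
  apply: (good_isolated cycle_power_sym (v := Ordinal an)).
  - by rewrite inE eqxx.
  - move=> w; rewrite inE /cycle_power /=; have := ltn_ord w; lia.
  suff : good e d (segment (a + k.+1) b).
    congr (good e _ _); apply/setP=> i; rewrite !inE -val_eqE /=; lia.
  by apply: IH; lia.
have vn : a + (k - j) < n by lia.
apply: (good_delete cycle_power_sym cycle_power_irr (v := Ordinal vn)).
- by rewrite inE /=; lia.
- have := IHj (ltnW jk); congr (good e _ _); apply/setP=> i; rewrite !inE -val_eqE /=; lia.
(* The deleted vertex is adjacent to [a] and to the next [k] vertices; at most [2 * k + 1] vertices
   of the original segment are lost. *)
suff : good e d (segment (a + (k - j) + k.+1) b).
  congr (good e _ _); apply/setP=> i; rewrite !inE -val_eqE /cycle_power /=.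
  have := ltn_ord i; lia.
by apply: IH; lia.
Qed.

Lemma good_cycle_power d : k < n -> d * (2 * k + 1) < n - k -> good e d [set: 'I_n].
Proof.
move=> kn dn; have n0 : 0 < n by lia.
case: d dn => [|d] dn; first exact: (good0 cycle_power_irr (v := Ordinal n0)).
suff step j : j <= k -> good e d.+1 (segment 0 (n - k + j)).
  have := step k (leqnn k); congr (good e _ _); apply/setP=> i; rewrite !inE.
  have := ltn_ord i; lia.
elim: j => [|j IHj] jk; first by apply: good_segment; lia.
have vn : n - k + j < n by lia.
apply: (good_delete cycle_power_sym cycle_power_irr (v := Ordinal vn)).
- by rewrite inE /=; lia.
- have := IHj (ltnW jk); congr (good e _ _); apply/setP=> i; rewrite !inE -val_eqE /=; lia.
(* The vertex [n - k + j] is adjacent to the [k] vertices before it and, around the cycle, to 0,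
   ..., [j]; the segment left has [n - 2k - 1] vertices for every [j]. *)
suff : good e d (segment j.+1 (n - k + j - k)).
  congr (good e _ _); apply/setP=> i; rewrite !inE -val_eqE /cycle_power /=.
  have := ltn_ord i; lia.
by apply: good_segment; lia.
Qed.

End CyclePower.

(** * From interval partitions to Stanley decompositions *)

Section Monomials.
Variables (K : fieldType) (n : nat).
Local Notation S := {mpoly K[n]}.
Local Open Scope ring_scope.
Implicit Types (p q : S) (m : 'X_{1..n}) (F W : {set 'I_n}).

Definition supp m := [set i | m i != 0%N].

Definition squarefree F : 'X_{1..n} := [multinom nat_of_bool (i \in F) | i < n].

Lemma supp_squarefree F : supp (squarefree F) = F.
Proof. by apply/setP=> i; rewrite inE mnmE; case: (i \in F). Qed.

Lemma squarefree_le F m : (squarefree F <= m)%MM = (F \subset supp m).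
Proof.
apply/mnm_lepP/subsetP => [le i iF|sub i].
  by rewrite inE -lt0n; have := le i; rewrite mnmE iF.
by rewrite mnmE; case: (boolP (i \in F)) => // /sub; rewrite inE -lt0n.
Qed.

(** The truncated [m - m0] is a true quotient whenever [Q m] implies that [m0] divides [m], as
    [mcoeff_part] assumes. *)
Definition quotient_part (Q : pred 'X_{1..n}) m0 p : S :=
  \sum_(m <- msupp p | Q m) p@_m *: 'X_[m - m0].

Lemma mcoeff_part (Q : pred 'X_{1..n}) m0 p m : (forall m', Q m' -> (m0 <= m')%MM) ->
  ('X_[m0] * quotient_part Q m0 p)@_m = if Q m then p@_m else 0.
Proof.
move=> Qm0; rewrite mulr_sumr raddf_sum /=.
under eq_bigr => m' Qm' do rewrite -scalerAr -mpolyXD addmC submK ?Qm0 // mcoeffZ mcoeffX.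
have [mp|mp] := boolP (m \in msupp p); last first.
  rewrite (memN_msupp_eq0 mp) if_same big1_seq // => m' /andP[_ m'p].
  by case: eqVneq m'p => [->|]; rewrite ?(negPf mp) ?mulr0.
rewrite -big_filter; case: ifP => Qm.
  rewrite (bigD1_seq m) ?mem_filter ?Qm ?filter_uniq //= eqxx mulr1 big1 ?addr0 // => m'.
  by move=> /negPf->; rewrite mulr0.
rewrite big_filter big1 // => m' Qm'; case: eqVneq Qm' => [->|]; rewrite ?Qm ?mulr0 //.
Qed.

(** Membership is decided monomial by monomial: the generator divides [m] iff [F] lies in the
    support, and since [F \subset W] the quotient uses only variables of [W] iff [m] does. *)
Lemma stanley_spaceP F W p : F \subset W ->
  stanley_space 'X_[squarefree F] W p <->
  (forall m, m \in msupp p -> between (F, W) (supp m)).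
Proof.
move=> FW; split=> [[q [qW ->]] m|supp_p].
  rewrite mulrC (perm_mem (msuppMX _ _)) => /mapP[m' m'q ->].
  apply/andP; split; apply/subsetP=> i.
    by move=> /= iF; rewrite inE mnmDE mnmE iF.
  rewrite inE mnmDE mnmE => nz; apply: contraT => iW.
  by move: nz; rewrite (qW _ m'q) // addn0 (contraNF (subsetP FW i) iW).
exists (quotient_part (fun m => between (F, W) (supp m)) (squarefree F) p).
have Qle m : between (F, W) (supp m) -> (squarefree F <= m)%MM.
  by rewrite squarefree_le => /andP[].
split; last first.
  apply/mpolyP=> m; rewrite mcoeff_part //; case: ifPn => // nQ.
  by apply: memN_msupp_eq0; apply: contra nQ => /supp_p.
move=> m mq i iW; apply/eqP; apply: contraNT iW => mi.
have : (m + squarefree F)%MM \in msupp ('X_[squarefree F] *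
    quotient_part (fun m => between (F, W) (supp m)) (squarefree F) p).
  by rewrite mulrC (perm_mem (msuppMX _ _)) addmC map_f.
rewrite mcoeff_msupp mcoeff_part //; case: ifP => [/andP[_ /subsetP/(_ i)]|]; last by rewrite eqxx.
by rewrite inE mnmDE; move=> + _; apply; rewrite addn_eq0 (negPf mi).
Qed.

Lemma edge_idealP (e : rel 'I_n) p : irreflexive e ->
  edge_ideal K e p <-> (forall m, m \in msupp p -> has_edge e (supp m)).
Proof.
move=> e_irr; split=> [[N [a [g [g_edge ->]]]] m|supp_p].
  move=> /msupp_sum_le/flattenP[_ /mapP[t _ ->]].
  have [i [j [eij ->]]] := g_edge t.
  rewrite -mpolyXD (perm_mem (msuppMX _ _)) => /mapP[m' _ ->].
  apply/has_edgeP; exists i, j; split=> //; rewrite inE !mnmDE !mnm1E eqxx; lia.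
pose ij m := [pick ij : 'I_n * 'I_n | [&& e ij.1 ij.2, m ij.1 != 0%N & m ij.2 != 0%N]].
have ijP m : m \in msupp p -> exists2 c, ij m = Some c &
    e c.1 c.2 /\ (U_(c.1) + U_(c.2) <= m)%MM.
  move=> /supp_p/has_edgeP[i [j]]; rewrite !inE => -[mi mj eij].
  rewrite /ij; case: pickP => [c /and3P[ec m1 m2]|/(_ (i, j))]; last by rewrite /= eij mi mj.
  exists c => //; split=> //; apply/mnm_lepP=> l; rewrite mnmDE !mnm1E.
  (* For equal ends, divisibility would require exponent 2. *)
  have c12 : c.1 != c.2 by apply: contraTneq ec => ->; rewrite e_irr.
  case: eqVneq => [<-|_]; first by rewrite eq_sym (negPf c12) lt0n.
  by case: eqVneq => [<-|//]; rewrite lt0n.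
pose s := msupp p; pose mon (t : 'I_(size s)) := tnth (in_tuple s) t.
have monP t : mon t \in msupp p by apply: mem_tnth.
(* By [ijP] the default 0 is never reached, here and in [a]. *)
pose g t : S := if ij (mon t) is Some c then 'X_(c.1) * 'X_(c.2) else 0.
pose a t : S := if ij (mon t) is Some c
  then p@_(mon t) *: 'X_[mon t - (U_(c.1) + U_(c.2))] else 0.
exists (size s), a, g; split=> [t|].
  rewrite /g; have [c -> [ec _]] := ijP _ (monP t); by exists c.1, c.2.
rewrite {1}[p]mpolyE big_tnth; apply: eq_bigr => t _; rewrite -/(mon t) /a /g.
by have [c -> [_ cm]] := ijP _ (monP t); rewrite -scalerAl -!mpolyXD submK.
Qed.

Lemma sdepth_edge_ideal (e : rel 'I_n) d : irreflexive e -> (d <= n)%N ->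
  partitionable d (has_edge e) -> (d <= sdepth (edge_ideal K e))%N.
Proof.
move=> e_irr dn [s s_part]; have [/allP ok cnt] := s_part.
pose r (i : 'I_(size s)) := tnth (in_tuple s) i.
have rs i : r i \in s by apply: mem_tnth.
have r_sub i : (r i).1 \subset (r i).2 by have /andP[] := ok _ (rs i).
pose Q i m := between (r i) (supp m).
(* Each monomial of the ideal belongs to exactly one space: existence gives the sum, uniqueness
   ([Q_inj]) its directness. *)
have sumQ m : (\sum_i Q i m = has_edge e (supp m))%N.
  rewrite -cnt -sum1_count [RHS]big_mkcond [RHS]big_tnth; apply: eq_bigr => i _.
  by rewrite -/(r i) /Q; case: between.
have Q_edge i m : Q i m -> has_edge e (supp m).
  move=> Qi; have := sumQ m; rewrite (bigD1 i) //= Qi.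
  by case: has_edge.
have Q_inj i j m : Q i m -> Q j m -> i = j.
  move=> Qi Qj; apply/eqP; apply: contraT => ij; have := sumQ m.
  rewrite (bigD1 i) //= Qi (bigD1 j) 1?eq_sym //= Qj.
  by case: has_edge.
pose gen i : S := 'X_[squarefree (r i).1].
have spaceP i f : stanley_space (gen i) (r i).2 f <->
    (forall m, m \in msupp f -> Q i m).
  rewrite stanley_spaceP //; by rewrite /Q -surjective_pairing.
have sd_genP i : edge_ideal K e (gen i).
  apply/edge_idealP => // m; rewrite msuppX inE => /eqP->; rewrite supp_squarefree.
  by have [] := interval_partition_ends s_part (rs i).
have sd_homog i : Zn_homogeneous (gen i).
  exists (fun j => (squarefree (r i).1 j)%:Z) => m; rewrite msuppX inE => /eqP-> //.
have sd_free i q : subpoly (r i).2 q -> gen i * q = 0 -> q = 0.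
  move=> _ gq; apply/mpolyP=> m.
  by rewrite -(mcoeffMX q (squarefree (r i).1)) mulrC -/(gen i) gq !mcoeff0.
have sd_sum p : edge_ideal K e p <-> exists f : 'I_(size s) -> S,
    (forall i, stanley_space (gen i) (r i).2 (f i)) /\ p = \sum_i f i.
  split=> [/edge_idealP-/(_ e_irr) supp_p|[f [fQ ->]]].
    (* With [m0 = 0] nothing is divided: [f i] collects the terms of [p] that lie in the space
       [i]. *)
    pose f i := 'X_[0%MM] * quotient_part (Q i) 0%MM p.
    have fE i m : (f i)@_m = if Q i m then p@_m else 0.
      by apply: mcoeff_part => m' _; apply/mnm_lepP=> j; rewrite mnm0E.
    exists f; split=> [i|].
      by apply/spaceP=> m; rewrite mcoeff_msupp fE; case: ifP; rewrite ?eqxx.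
    apply/mpolyP=> m; rewrite raddf_sum /=.
    transitivity (\sum_i p@_m *+ Q i m); last first.
      by apply: eq_bigr => i _; rewrite fE; case: (Q i m).
    rewrite sumrMnr sumQ; have [|mp] := boolP (m \in msupp p); first by move/supp_p->.
    by rewrite (memN_msupp_eq0 mp) mul0rn.
  apply/edge_idealP => // m /msupp_sum_le/flattenP[_ /mapP[i _ ->]].
  by move=> /(proj1 (spaceP i (f i)) (fQ i))/Q_edge.
have sd_direct (f : 'I_(size s) -> S) :
    (forall i, stanley_space (gen i) (r i).2 (f i)) ->
    \sum_i f i = 0 -> forall i, f i = 0.
  move=> fQ f0 i; apply/mpolyP=> m; rewrite mcoeff0; apply/eqP; apply: contraT.
  rewrite -mcoeff_msupp => mi; move/(congr1 (mcoeff m)): f0.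
  rewrite raddf_sum /= (bigD1 i) //= big1 => [|j ji].
    by rewrite addr0 mcoeff0 => /eqP; rewrite mcoeff_eq0 mi.
  apply: memN_msupp_eq0; apply: contra ji => mj.
  have inQ l := proj1 (spaceP l (f l)) (fQ l) m.
  by apply/eqP/(Q_inj j i m); apply: inQ.
pose D := StanleyDecomposition sd_genP sd_homog sd_free sd_sum sd_direct.
have dD : (d <= sdepth_dec D)%N.
  (* The default value [n] of the minimum is covered by [d <= n]. *)
  rewrite /sdepth_dec; elim/big_ind: _ => // [x y dx dy|i _]; first by rewrite leq_min dx.
  by have /andP[] := ok _ (rs i).
have Dn : (sdepth_dec D < n.+1)%N.
  rewrite ltnS /sdepth_dec; elim: index_enum => [|i l IH]; first by rewrite big_nil.
  by rewrite big_cons (leq_trans (geq_minr _ _)).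
apply: leq_trans dD _.
rewrite -[X in (X <= _)%N]/(nat_of_ord (Ordinal Dn)) /sdepth.
by apply: (leq_bigmax_cond (Ordinal Dn)); apply/asboolP; exists D.
Qed.

End Monomials.

(** The largest [d] with [d * b < a] is the floor of [(a - 1) / b], one less than the ceiling of
    [a / b]; the strict inequality is the form that [good_cycle_power] expects. *)
Lemma ceil_natr_div (a b : nat) : (0 < a)%N -> (0 < b)%N ->
  exists2 d : nat, Num.ceil (a%:R / b%:R : rat)%R = d.+1%:Z%R & (d * b < a)%N.
Proof.
move=> a0 b0; exists ((a - 1) %/ b); last first.
  by rewrite (leq_ltn_trans (leq_trunc_div _ _)) // subn1 prednK.
have b0' : (0 < b%:R :> rat)%R by rewrite ltr0n.
apply: ceil_def; rewrite ltr_pdivlMr // ler_pdivrMr //.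
rewrite -[_.+1%:Z%R]/(Posz _) -addn1 PoszD addrK.
rewrite -!pmulrn -!natrM ltr_nat ler_nat; apply/andP; split.
  by rewrite (leq_ltn_trans (leq_trunc_div _ _)) // subn1 prednK.
by have := ltn_ceil (a - 1) b0; rewrite addn1; lia.
Qed.

Theorem theorem5p4 (K : fieldType) (n k : nat) (hk : (1 <= k)%N) (hn : (3 <= n)%N) :
  ((n <= 2 * k + 1)%N ->
     (2 <= sdepth (edge_ideal K (cycle_power n k)))%N) /\
  ((2 * k + 2 <= n)%N ->
     (Num.ceil ((n%:R - k%:R) / (2 * k + 1)%:R : rat) + 1
        <= (sdepth (edge_ideal K (cycle_power n k)))%:Z)%R).
Proof.
have irr := @cycle_power_irr n k.
have sdepth_good d : good (cycle_power n k) d [set: 'I_n] -> (d.+2 <= n)%N ->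
    (d.+2 <= sdepth (edge_ideal K (cycle_power n k)))%N.
  move=> [_ part] dn; apply: sdepth_edge_ideal => //.
  by apply: eq_partitionable part => A; rewrite /dependent subsetT.
split=> nk.
  apply: sdepth_good; last exact: ltnW.
  by apply: (good0 irr (v := Ordinal (ltnW (ltnW hn)))); rewrite inE.
rewrite -natrB; last by lia.
have [|//|d -> dnk] := @ceil_natr_div (n - k) (2 * k + 1); try lia.
have kn : (k < n)%N by lia.
(* The ceiling is [d.+1], so the bound [d.+2] is the ceiling plus one. *)
have := sdepth_good d (good_cycle_power kn dnk); lia.
Qed.
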